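(* Suppose $H$ is a closed subgroup of a topological group $G$ for which there is a continuous left-invariant pseudometric $\partial$ on $G$ such that $$\mathcal E_\partial(G)\upharpoonright H=\mathcal E_L(G)\upharpoonright H,$$ and let $\pi\colon G\to H\backslash G$, $\pi(g)=Hg$, denote the quotient map. Then a subset $A\subseteq G$ is bounded if and only if ${\sf diam}_\partial(A)<\infty$ and $\pi[A]$ is $\mathcal E_{\rm Haus}(H\backslash G)$-bounded. It follows that every $\mathcal E_{\rm Haus}(H\backslash G)$-bounded set $B$ is of the form $B=\pi[A]$ for some bounded subset $A\subseteq G$.
   Context: A coarse structure on a set $X$ is an ideal $\mathcal E$ of subsets of $X\times X$ (closed under subsets and finite unions) containing the diagonal and closed under transposition and composition. A pseudometric $d$ on $X$ induces $\mathcal E_d(X)=\{E\subseteq X\times X:\sup_{(x,y)\in E}d(x,y)<\infty\}$. A set $A\subseteq X$ is $\mathcal E$-bounded if $A\times A\in\mathcal E$. For $Y\subseteq X$, the restriction is $\mathcal E\upharpoonright Y=\{E\in\mathcal E: E\subseteq Y\times Y\}$. For a topological group $G$, the left coarse structure is $\mathcal E_L(G)=\bigcap_d\mathcal E_d(G)$, where $d$ ranges over all continuous left-invariant pseudometrics on $G$. A subset of $G$ is called bounded if it is $\mathcal E_L(G)$-bounded. For a closed subgroup $H$, $H\backslash G$ is the set of right cosets $Hg$, and $\mathcal E_{\rm Haus}(H\backslash G)=\bigcap_d\mathcal E_{d_{\rm Haus}}(H\backslash G)$, where $d$ ranges over the continuous left-invariant pseudometrics on $G$ and $d_{\rm Haus}$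 is the Hausdorff distance between cosets with respect to $d$, which satisfies $d_{\rm Haus}(Hg,Hf)=\inf_{h\in H}d(hg,f)$. *)

(* Defs.v *)
From HB Require Import structures.
From mathcomp Require Import all_boot all_order all_algebra.
From mathcomp Require Import all_classical all_reals all_analysis.

Set Implicit Arguments.
Unset Strict Implicit.
Unset Printing Implicit Defensive.
Import Order.TTheory GRing.Theory Num.Theory.
Import numFieldNormedType.Exports.

Local Open Scope classical_set_scope.
Local Open Scope ring_scope.

(* MathComp-Analysis only has commutative (additive) topological groups. No
   separation axiom is imposed. *)
HB.mixin Record Topological_Group_isTopologicalGroup G
    of Topological G & Group G := {
  mulg_continuous : continuous (fun p : G * G => (p.1 * p.2)%g) ;
  invg_continuous : continuous (fun x : G => (x^-1)%g)
}.

#[short(type="topologicalGroupType")]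
HB.structure Definition TopologicalGroup :=
  {G of Topological_Group_isTopologicalGroup G & Topological G & Group G}.

Record pseudometric (R : realType) (X : Type) (d : X -> X -> R) : Prop := {
  pseudometric_ge0 : forall x y, 0 <= d x y ;
  pseudometric_refl : forall x, d x x = 0 ;
  pseudometric_sym : forall x y, d x y = d y x ;
  pseudometric_triangle : forall x y z, d x z <= d x y + d y z
}.

(* Distances take values in \bar R so that suprema and infima need no
   finiteness side condition. The supremum over the empty set is -oo. *)
Definition sup_dist (R : realType) (X : Type) (d : X -> X -> \bar R)
    (E : set (X * X)) : \bar R :=
  ereal_sup [set d p.1 p.2 | p in E].

Definition dist_coarse (R : realType) (X : Type) (d : X -> X -> \bar R) :
    set (set (X * X)) :=
  [set E | (sup_dist d E < +oo)%E].

Definition coarse_bounded (X : Type) (E : set (set (X * X))) (A : set X) :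
    Prop :=
  E (A `*` A).

Definition coarse_restrict (X : Type) (E : set (set (X * X))) (Y : set X) :
    set (set (X * X)) :=
  [set F | E F /\ F `<=` Y `*` Y].

(* A real-valued pseudometric seen as a distance with values in \bar R. *)
Definition ext_dist (R : realType) (X : Type) (d : X -> X -> R) (x y : X) :
    \bar R := (d x y)%:E.

(* The empty set has diameter -oo rather than 0; finiteness from above is not
   affected. *)
Definition diam (R : realType) (X : Type) (d : X -> X -> R) (A : set X) :
    \bar R := sup_dist (ext_dist d) (A `*` A).

Definition hausdorff_dist (R : realType) (X : Type) (d : X -> X -> R)
    (A B : set X) : \bar R :=
  Order.max
    (ereal_sup [set ereal_inf [set (d a b)%:E | b in B] | a in A])
    (ereal_sup [set ereal_inf [set (d a b)%:E | a in A] | b in B]).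

Definition left_invariant (R : realType) (G : groupType) (d : G -> G -> R) :
    Prop :=
  forall g x y : G, d (g * x)%g (g * y)%g = d x y.

Definition cont_left_inv_pseudometric (R : realType)
    (G : topologicalGroupType) : set (G -> G -> R) :=
  [set d | [/\ pseudometric d, left_invariant d &
               continuous (fun p : G * G => d p.1 p.2)]].
Arguments cont_left_inv_pseudometric : clear implicits.

Definition left_coarse (R : realType) (G : topologicalGroupType) :
    set (set (G * G)) :=
  \bigcap_(d in cont_left_inv_pseudometric R G) dist_coarse (ext_dist d).
Arguments left_coarse : clear implicits.

Definition group_bounded (R : realType) (G : topologicalGroupType)
    (A : set G) : Prop :=
  coarse_bounded (left_coarse R G) A.
Arguments group_bounded R {G} A.

Definition right_coset (G : groupType) (H : set G) (g : G) : set G :=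
  [set (h * g)%g | h in H].

(* H\G: through the coercion of sets to types, also the type of the right
   cosets Hg. *)
Definition right_cosets (G : groupType) (H : set G) : set (set G) :=
  range (right_coset H).

Definition coset_proj (G : groupType) (H : set G) (g : G) : right_cosets H :=
  SigSub (mem_set (imageT (right_coset H) g)).

Definition haus_coarse (R : realType) (G : topologicalGroupType)
    (H : set G) : set (set (right_cosets H * right_cosets H)) :=
  \bigcap_(d in cont_left_inv_pseudometric R G)
    dist_coarse (fun C D : right_cosets H => hausdorff_dist d (\val C) (\val D)).
Arguments haus_coarse R {G} H.

(* Main.v *)
(** Compare a point [a] of [A] with a base point [a0]: since [H a] is close to
    [H a0] for [d + del], some [h] in [H] has [a] close to [h a0] for [d] and
    for [del] simultaneously. As [A] has finite [del]-diameter, these [h] stay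
    in a [del]-ball of [H], which by hypothesis is [d]-bounded. Hence [a] is at
    bounded [d]-distance from [a0]. *)
Require Import Defs.
From mathcomp Require Import all_boot all_order all_algebra.
From mathcomp Require Import all_classical all_reals all_analysis.
From mathcomp Require Import lra.
Set Implicit Arguments.
Unset Strict Implicit.
Import Order.TTheory GRing.Theory Num.Theory.
Import numFieldNormedType.Exports.
Local Open Scope classical_set_scope.
Local Open Scope ring_scope.

Lemma sup_dist_lt_pinftyP (R : realType) (X : Type) (d : X -> X -> \bar R)
    (E : set (X * X)) :
  (sup_dist d E < +oo)%E <->
  exists K : R, forall x y, E (x, y) -> (d x y <= K%:E)%E.
Proof.
split => [|[K dK]]; last first.
  apply: (@le_lt_trans _ _ K%:E); last exact: ltry.
  by apply: ge_ereal_sup => _ [[x y] Exy <-]; exact: dK.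
have dS x y : E (x, y) -> (d x y <= sup_dist d E)%E.
  by move=> Exy; apply: ereal_sup_ubound; exists (x, y).
case: (sup_dist d E) dS => [K dK _|//|dN _]; first by exists K.
(* The supremum is [-oo], as it is for empty [E]; any real number is then a bound. *)
by exists 0 => x y /dN /le_trans; apply; exact: leNye.
Qed.

(** The infimum over [A] need not be attained, hence the strictly larger radius [L]. *)
Lemma hausdorff_dist_near (R : realType) (X : Type) (d : X -> X -> R)
    (A B : set X) (K L : R) (b : X) :
  (hausdorff_dist d A B <= K%:E)%E -> K < L -> B b ->
  exists2 a, A a & d a b < L.
Proof.
rewrite /hausdorff_dist ge_max => /andP[_ AB] KL Bb.
have : (ereal_inf [set (d a b)%:E | a in A] < L%:E)%E.
  apply: (@le_lt_trans _ _ K%:E); last by rewrite lte_fin.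
  by apply: le_trans AB; apply: ereal_sup_ubound; exists b.
by case/ereal_inf_lt => _ [a Aa <-]; rewrite lte_fin; exists a.
Qed.

(** Left invariance pairs [h * a] with [h * b] at the same distance for every [h] in [H]. Thus the
    quotient map is nonexpansive. *)
Lemma hausdorff_dist_coset_le (R : realType) (G : groupType) (H : set G)
    (d : G -> G -> R) (a b : G) :
  left_invariant d ->
  (hausdorff_dist d (right_coset H a) (right_coset H b) <= (d a b)%:E)%E.
Proof.
move=> dL; rewrite /hausdorff_dist ge_max; apply/andP; split;
  apply: ge_ereal_sup => _ [_ [h Hh <-] <-]; apply: ereal_inf_lbound.
  by exists (h * b)%g; [exists h|rewrite dL].
by exists (h * a)%g; [exists h|rewrite dL].
Qed.

(** Closeness of cosets for the sum yields a single element of [H] that works for both pseudometrics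
    at once. *)
Lemma cont_left_inv_pseudometricD (R : realType) (G : topologicalGroupType)
    (d e : G -> G -> R) :
  cont_left_inv_pseudometric R G d -> cont_left_inv_pseudometric R G e ->
  cont_left_inv_pseudometric R G (fun x y => d x y + e x y).
Proof.
move=> [[d0 dr ds dt] dL dc] [[e0 er es et] eL ec]; split.
- split=> [x y|x|x y|x y z]; first exact: addr_ge0.
  + by rewrite dr er addr0.
  + by rewrite ds es.
  + by have := dt x y z; have := et x y z; lra.
- by move=> g x y; rewrite dL eL.
- by move=> p; apply: cvgD; [exact: dc|exact: ec].
Qed.

Lemma coset_proj_surj (G : groupType) (H : set G) (C : right_cosets H) :
  exists g, C = coset_proj H g.
Proof.
have [g _ gC] := set_mem (valP C).
by exists g; apply: val_inj; rewrite /= gC.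
Qed.

Lemma coset_proj_mull (G : groupType) (H : set G) (h g : G) :
  group_closed (mem H) -> H h -> coset_proj H (h * g)%g = coset_proj H g.
Proof.
move=> Hgrp Hh; apply: val_inj; apply/seteqP; split=> _ [k Hk <-].
  exists (k * h)%g; last by rewrite mulgA.
  apply: set_mem; apply: (group_closedM Hgrp); exact: mem_set.
exists (k * h^-1)%g; last by rewrite mulgA mulgVK.
by apply: set_mem; apply: Hgrp.2; exact: mem_set.
Qed.

(** Through the centre [1], any two points of the ball are within [C + C] for [del], so the
    hypothesis applies to the square of the ball. *)
Lemma group_bounded_subgroup_ball (R : realType) (G : topologicalGroupType)
    (H : set G) (del : G -> G -> R) (C : R) :
  pseudometric del ->
  coarse_restrict (dist_coarse (ext_dist del)) H `<=` left_coarse R G ->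
  group_bounded R [set h | H h /\ del h 1%g <= C].
Proof.
move=> [_ _ dels delt]; apply; split; last by move=> [x y] [[? _] [? _]].
apply/sup_dist_lt_pinftyP; exists (C + C) => x y [[_ /= xC] [_ /= yC]].
by rewrite lee_fin (le_trans (delt x 1%g y))// lerD// dels.
Qed.

Lemma group_bounded_diam_proj (R : realType) (G : topologicalGroupType)
    (H : set G) (del : G -> G -> R) (A : set G) :
  group_closed (mem H) -> cont_left_inv_pseudometric R G del ->
  coarse_restrict (dist_coarse (ext_dist del)) H `<=` left_coarse R G ->
  (diam del A < +oo)%E ->
  coarse_bounded (haus_coarse R H) (coset_proj H @` A) ->
  group_bounded R A.
Proof.
move=> Hgrp del_cont del_restrict /sup_dist_lt_pinftyP[D AD] Abnd d d_cont.
have [del_metric delL _] := del_cont.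
have [del0 delr dels delt] := del_metric.
have [[d0 _ ds dt] dL _] := d_cont.
have [->|/set0P[a0 Aa0]] := eqVneq A set0.
  by apply/sup_dist_lt_pinftyP; exists 0 => x y [].
have /sup_dist_lt_pinftyP[K AK] :=
  Abnd _ (cont_left_inv_pseudometricD d_cont del_cont).
(* Length for [del] of the path from [h^-1] through [h^-1 * a0], [x] and [a0] to [1]. *)
set C := K + 1 + D + del a0 1%g + del a0 1%g.
have /sup_dist_lt_pinftyP[M HM] := group_bounded_subgroup_ball C
  del_metric del_restrict d_cont.
have H1 : H 1%g by exact: (set_mem Hgrp.1).
have D0 : 0 <= D.
  by apply: le_trans (del0 a0 a0) _; rewrite -lee_fin; apply: AD.
(* Length for [d] of the path from [x] through [h^-1 * a0] and [h^-1] to [1]. *)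
set N := K + 1 + d a0 1%g + M.
suff da x : A x -> d x 1%g <= N.
  apply/sup_dist_lt_pinftyP; exists (N + N) => x y [/= /da xN /da yN].
  by rewrite lee_fin (le_trans (dt x 1%g y))// lerD// ds.
move=> Ax.
have KK1 : K < K + 1 by rewrite ltrDl.
have Ha0 : right_coset H a0 a0 by exists 1%g; rewrite ?mul1g.
have near_x : (hausdorff_dist (fun x y => d x y + del x y)%R
    (right_coset H x) (right_coset H a0) <= K%:E)%E.
  by apply: (AK (coset_proj H x) (coset_proj H a0)); split; [exists x|exists a0].
have [_ [h Hh <-] hxK] := hausdorff_dist_near near_x KK1 Ha0.
have Hk : H h^-1%g.
  by rewrite -[h^-1%g]mul1g; apply: set_mem; apply: Hgrp.2; exact: mem_set.
(* Translating by [h^-1] turns closeness of [h * x] to [a0] into closeness of [x] to [h^-1 * a0]. *)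
have kE (e : G -> G -> R) : left_invariant e ->
    e (h^-1 * a0)%g x = e a0 (h * x)%g /\ e h^-1%g (h^-1 * a0)%g = e 1%g a0.
  by move=> eL; rewrite -(eL h _ x) -(eL h h^-1%g) mulgA mulgV mul1g.
have [dkx dk] := kE d dL; have [delkx delk] := kE del delL.
(* Both summands are nonnegative, so each is below [K + 1]. *)
have := d0 (h * x)%g a0; have := del0 (h * x)%g a0 => hx0 dhx0.
have delxa0 : del x a0 <= D by rewrite -lee_fin; apply: AD.
have kC : del h^-1%g 1%g <= C.
  have := delt h^-1%g (h^-1 * a0)%g 1%g; have := delt (h^-1 * a0)%g x 1%g.
  have := delt x a0 1%g; rewrite delkx delk (dels 1%g) (dels a0 (h * x)%g) /C.
  by lra.
(* [M] bounds distances between pairs in the ball, so [1] must lie in it too. *)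
have C0 : del 1%g 1%g <= C by rewrite delr /C; have := del0 a0 1%g; lra.
have dkM : d h^-1%g 1%g <= M.
  by have := HM h^-1%g 1%g (conj (conj Hk kC) (conj H1 C0)); rewrite lee_fin.
have := dt x (h^-1 * a0)%g 1%g; have := dt (h^-1 * a0)%g h^-1%g 1%g.
rewrite (ds x (_ * _)%g) dkx (ds _ h^-1%g) dk (ds 1%g) (ds a0 (h * x)%g) /N.
by lra.
Qed.

Theorem proposition5 (R : realType) (G : topologicalGroupType) (H : set G)
    (H_subgroup : group_closed (mem H)) (H_closed : closed H)
    (del : G -> G -> R)
    (del_cont : cont_left_inv_pseudometric R G del)
    (del_restrict :
       coarse_restrict (dist_coarse (ext_dist del)) H =
       coarse_restrict (left_coarse R G) H) :
  (forall A : set G,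
     group_bounded R A <->
     (diam del A < +oo)%E /\
     coarse_bounded (haus_coarse R H) (coset_proj H @` A)) /\
  (forall B : set (right_cosets H),
     coarse_bounded (haus_coarse R H) B ->
     exists A : set G, group_bounded R A /\ B = coset_proj H @` A).
Proof.
have del_sub :
    coarse_restrict (dist_coarse (ext_dist del)) H `<=` left_coarse R G.
  by rewrite del_restrict => E [].
have criterion A :=
  @group_bounded_diam_proj R G H del A H_subgroup del_cont del_sub.
split=> [A|B Bbnd].
  split=> [Abnd|[]]; last exact: criterion.
  (* [del] is one of the pseudometrics that define [left_coarse]. *)
  split=> [|d d_cont]; first exact: Abnd.
  have /sup_dist_lt_pinftyP[K AK] := Abnd d d_cont.
  apply/sup_dist_lt_pinftyP; exists K => _ _ [/= [x Ax <-] [y Ay <-]].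
  apply: le_trans (AK x y (conj Ax Ay)).
  by apply: hausdorff_dist_coset_le; case: d_cont.
have [->|/set0P[C0 BC0]] := eqVneq B set0.
  exists set0; split; last by rewrite image_set0.
  by move=> d _; apply/sup_dist_lt_pinftyP; exists 0 => x y [].
have [a0 C0E] := coset_proj_surj C0.
have /sup_dist_lt_pinftyP[K BK] := Bbnd del del_cont.
have KK1 : K < K + 1 by rewrite ltrDl.
(* All cosets in [B] are within [K] of that of [a0], so each has a representative in the open
   [del]-ball of radius [K + 1] about [a0]. Keeping only such representatives makes the diameter
   finite without losing any coset. *)
pose A := [set g | B (coset_proj H g) /\ del g a0 < K + 1].
have piA : B = coset_proj H @` A.
  apply/seteqP; split=> [C|_ [g [Bg _] <-]//].
  have [c ->] := coset_proj_surj C => Bc.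
  have Ca0 : (\val C0) a0.
    by rewrite C0E; exists 1%g; rewrite ?mul1g//; exact: (set_mem H_subgroup.1).
  have [_ [h Hh <-] hcK] := hausdorff_dist_near (BK _ _ (conj Bc BC0)) KK1 Ca0.
  have hcE := coset_proj_mull c H_subgroup Hh.
  by exists (h * c)%g; [split; rewrite /= ?hcE|].
exists A; split=> //; apply: criterion; last by rewrite -piA.
have [[_ _ dels delt] _ _] := del_cont.
apply/sup_dist_lt_pinftyP; exists (K + 1 + (K + 1)) => x y [[_ xK] [_ yK]].
by rewrite lee_fin (le_trans (delt x a0 y))// lerD// ltW// dels.
Qed.
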